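(* Let $n$ be an odd integer, and let $R=(r_1,\ldots,r_{(n-1)/2},r_{(n+1)/2},r_{(n-1)/2},\ldots,r_1)$ be a vector of nonnegative integers such that $(r_1,r_2,\ldots,r_{(n-1)/2})$ is nondecreasing. Then there exists a combinatorially skew-Hankel tournament with score vector $R$ if and only if $$\sum_{i=1}^k r_i\ge k(k-1)+\left(k-\frac{r_{(n+1)/2}}{2}\right)^+\quad\left(k=1,2,\ldots,\frac{n-1}{2}\right),\ \mbox{ with equality if } k=\frac{n-1}{2}.$$
   Context: A combinatorially skew-Hankel tournament of order $n$ is an $n\times n$ $(0,1)$-matrix $T=[t_{ij}]$ such that $t_{ii}=t_{i,n+1-i}=0$ for all $i$, and, for all $i$ and all $j\ne i,n+1-i$, $t_{ji}=1-t_{ij}$ and $t_{n+1-j,n+1-i}=1-t_{ij}$. (Hence $t_{ij}=t_{n+1-i,n+1-j}$ for all $i,j$.) Its score vector is the vector of its row sums. For a number $a$, $a^+=\max\{0,a\}$.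
   Formalization: The condition $r_{(n+1)/2}\le n-1$ is added to the right-hand side of the equivalence; without it the ''if'' direction fails, e.g. for $n=3$, $R=(0,3,0)$, which satisfies the inequalities but is not a score vector. *)

(* Defs.v *)
From mathcomp Require Import all_boot all_order all_algebra.
Set Implicit Arguments. Unset Strict Implicit. Unset Printing Implicit Defensive.
Import Order.TTheory GRing.Theory Num.Theory.

Local Open Scope ring_scope.

(* Indices are 0-based: [rev_ord i] is the index written n + 1 - i when rows   *)
(* and columns are numbered from 1. The subtraction on [nat] never truncates,  *)
(* since the entries are 0 or 1.                                               *)
Definition comb_skew_Hankel_tournament (n : nat) (T : 'M[nat]_n) : Prop :=
  [/\ forall i j : 'I_n, T i j = 0%N \/ T i j = 1%N,
      forall i : 'I_n, T i i = 0%N /\ T i (rev_ord i) = 0%N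
    & forall i j : 'I_n, j != i -> j != rev_ord i ->
        T j i = (1 - T i j)%N /\ T (rev_ord j) (rev_ord i) = (1 - T i j)%N].

Definition score_vector (n : nat) (T : 'M[nat]_n) : 'rV[nat]_n :=
  \row_i (\sum_(j < n) T i j)%N.

Definition pos_part (a : rat) : rat := Num.max 0 a.

Lemma half_ltn_odd (n : nat) : odd n -> (n./2 < n)%N.
Proof. by case: n => // n _; rewrite ltnS leq_uphalf_double -addnn leq_addr. Qed.

(* The index written (n + 1) / 2 when numbering from 1. *)
Definition mid (n : nat) (n_odd : odd n) : 'I_n := Ordinal (half_ltn_odd n_odd).

Definition palindromic (n : nat) (R : 'rV[nat]_n) : Prop :=
  forall i : 'I_n, R ord0 (rev_ord i) = R ord0 i.

(* n./2 = (n - 1) / 2 for odd n. *)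
Definition first_half_nondecreasing (n : nat) (R : 'rV[nat]_n) : Prop :=
  forall i j : 'I_n, (i <= j)%N -> (j < n./2)%N -> (R ord0 i <= R ord0 j)%N.

Definition prefix_sum (n : nat) (R : 'rV[nat]_n) (k : nat) : nat :=
  (\sum_(i < n | i < k) R ord0 i)%N.

(* The middle entry r may be odd, so r / 2 is taken in the rationals. *)
Definition score_bound (r k : nat) : rat :=
  k%:R * (k%:R - 1) + pos_part (k%:R - r%:R / 2).

Definition score_inequalities (n : nat) (n_odd : odd n) (R : 'rV[nat]_n) : Prop :=
  forall k : nat, (1 <= k <= n./2)%N ->
    score_bound (R ord0 (mid n_odd)) k <= (prefix_sum R k)%:R /\
    (k = n./2 -> (prefix_sum R k)%:R = score_bound (R ord0 (mid n_odd)) k).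

(* Main.v *)
Require Import Defs.
From mathcomp Require Import all_boot all_order all_algebra.
From mathcomp Require Import zify ring.
Import Order.TTheory GRing.Theory Num.Theory.

Set Implicit Arguments. Unset Strict Implicit. Unset Printing Implicit Defensive.

Local Open Scope ring_scope.

(** Write m = (n - 1) / 2.  A combinatorially skew-Hankel tournament is
    invariant under the half turn (i, j) -> (i', j'), where i' is the reversal
    of i, so the rows up to the middle one determine it.  Fold the matrix by
    identifying j with j', and let a x y add up the entries of row x in the
    columns y and y'.  For x <> y before the middle, the pair {x, y} then has
    2 points to share, a x y + a y x = 2, and every way of sharing them comes
    from a tournament.  The middle row shares 1 point with each x; its own
    score counts each of its points twice, and so it is even.  Hence R is a
    score vector iff its middle entry is 2h for some h and the weights
    w x y = 2 (or 1, when x or y is the middle) can be split into two parts,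
    a x y + a y x = w x y, with row sums r_1, ..., r_m, h.  This translation is
    [score_vector_folded] and, for the existence of the tournament,
    [unfold_splits].

    Prescribed row sums q can be realized by a splitting of w iff, for every
    set K, the sum of q over K is at least the total weight of the pairs in K,
    with equality for the set of all vertices ([splits_with_sums]); this is the
    theorem of Landau and Hakimi on tournaments and orientations.  Necessity is
    counting.  For sufficiency, as long as some row sum is too large, follow
    the positive entries from that row: either they lead to a row whose sum is
    too small, and one unit can be moved along the path, or the set of rows
    that they reach violates the condition.

    For the folded weights, a set of k rows before the middle must have score
    at least k(k - 1), and the same set with the middle row added must have
    score at least k^2.  Both are hardest for the first k rows, whose scores
    are the smallest ([prefix_sum_min]), where they read
    r_1 + ... + r_k >= k(k - 1) and r_1 + ... + r_k >= k(k - 1) + (k - h).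
    Together they are exactly the inequality with the positive part, and
    equality on all rows is its case of equality ([folded_inequalities]). *)

(** * Splitting weights with prescribed row sums *)

Definition splits {V : finType} (w a : V -> V -> nat) : Prop :=
  forall x y, (a x y + a y x)%N = w x y.

Lemma sum_splits (V : finType) (w a : V -> V -> nat) (P : pred V) :
  splits w a ->
  (\sum_(x | P x) \sum_(y | P y) w x y =
   2 * \sum_(x | P x) \sum_(y | P y) a x y)%N.
Proof.
move=> aw; rewrite mul2n -addnn [X in (_ + X)%N]exchange_big -big_split /=.
by apply: eq_bigr => x _; rewrite -big_split; apply: eq_bigr => y _; rewrite /= aw.
Qed.

(** Moving one unit from each entry of a simple path to the transposed entry
    changes only the row sums at its two ends.  Simplicity guarantees that the
    entries of the rest of the path are still positive after the first move. *)
Lemma reverse_path (V : finType) (w a : V -> V -> nat) (u : V) (p : seq V) :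
    splits w a -> path (fun x y => 0 < a x y)%N u p -> uniq (u :: p) ->
  exists2 a', splits w a' & forall x,
    (\sum_y a' x y + (x == u) = \sum_y a x y + (x == last u p))%N.
Proof.
elim: p a u => [|v p IHp] a u aw /=; first by exists a.
case/andP=> auv a_p /andP[]; rewrite inE negb_or => /andP[u'v u'p] uniq_p.
pose a1 x y := (a x y + (x == v) * (y == u) - (x == u) * (y == v))%N.
have a1E x y : (a1 x y + (x == u) * (y == v) = a x y + (x == v) * (y == u))%N.
  by rewrite /a1; case: (x =P u) => [->|_]; case: (y =P v) => [->|_]; lia.
have a1w : splits w a1.
  move=> x y; have := a1E x y; have := a1E y x; have := aw x y; nia.
have a1_p : path (fun x y => 0 < a1 x y)%N v p.
  have avoid_u : all (fun x => x != u) (v :: p).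
    by apply/allP=> x xp; apply: contraTneq xp => ->; rewrite inE negb_or u'v.
  apply: (sub_in_path (P := fun x => x != u)) avoid_u a_p => x y x'u y'u axy.
  by have := a1E x y; rewrite (negPf x'u) (negPf y'u); lia.
have [a' a'w a'E] := IHp a1 v a1w a1_p uniq_p.
exists a' => // x; have := a'E x.
have delta (z : V) : (\sum_y (y == z) = 1)%N.
  by rewrite (bigD1 z) //= eqxx big1 // => y /negPf->.
have: (\sum_y (a1 x y + (x == u) * (y == v)) =
      \sum_y (a x y + (x == v) * (y == u)))%N by apply: eq_bigr => y _.
rewrite !big_split -!big_distrr /= !delta; lia.
Qed.

(** Sums over ordered pairs count every pair of distinct vertices twice, which
    is where the factor 2 comes from. *)
Lemma splits_with_sums (V : finType) (w : V -> V -> nat) (q : V -> nat) :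
    (forall x y, w x y = w y x) -> (forall x, w x x = 0%N) ->
  (exists2 a, splits w a & forall x, (\sum_y a x y)%N = q x) <->
  (forall K : {set V},
     (\sum_(x in K) \sum_(y in K) w x y <= 2 * \sum_(x in K) q x)%N) /\
  (\sum_x \sum_y w x y = 2 * \sum_x q x)%N.
Proof.
move=> wC w0; split=> [[a aw aq] | [q_ge q_tot]].
  split=> [K|].
    rewrite (sum_splits (mem K) aw) leq_mul2l; apply: leq_sum => x _.
    by rewrite -aq [leqRHS](bigID (mem K)) leq_addr.
  by rewrite (sum_splits xpredT aw); congr (2 * _)%N; apply: eq_bigr.
pose excess (a : V -> V -> nat) := (\sum_x (\sum_y a x y - q x))%N.
have [a0 a0w] : exists a, splits w a.
  (* Any orientation will do as a start: give each weight to the vertex of the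
     pair that is enumerated first. *)
  exists (fun x y => if (enum_rank x < enum_rank y)%N then w x y else 0)%N.
  move=> x y; case: ltngtP => [_|_|/val_inj/enum_rank_inj->].
  - exact: addn0.
  - exact: wC.
  - by rewrite w0.
have [N] := ubnP (excess a0); elim: N a0 a0w => // N IHN a aw a_lt.
have a_tot : (\sum_x \sum_y a x y = \sum_x q x)%N.
  by have := sum_splits xpredT aw; rewrite q_tot; lia.
(* The row sums and q have the same total, so without any excess they agree. *)
have [u qu|a_le] := pickP (fun u => q u < \sum_y a u y)%N; last first.
  exists a => // x; apply/eqP; move: x (erefl true).
  have le x : true -> (\sum_y a x y <= q x ?= iff (\sum_y a x y == q x))%N.
    by move=> _; split=> //; rewrite leqNgt a_le.
  have [_] := leqif_sum le; rewrite a_tot eqxx => /esym/forallP H x _.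
  exact: (implyP (H x)).
pose K := [set v | connect (fun x y => 0 < a x y)%N u v].
have Ku : u \in K by rewrite inE connect0.
(* If a row reached from u has too small a sum, moving a unit along the path
   reduces the excess. *)
have [v /andP[Kv vq]|K_ge] :=
  pickP (fun v => (v \in K) && (\sum_y a v y < q v)%N).
  move: Kv; rewrite inE => /connectP[p0 /shortenP[p a_p uniq_p _] v_last].
  have [a' a'w a'E] := reverse_path aw a_p uniq_p.
  apply: (IHN a' a'w); rewrite ltnS in a_lt; apply: leq_trans a_lt.
  have v'u : v != u by apply: contraTneq vq => ->; rewrite -leqNgt ltnW.
  rewrite /excess (bigD1 u) // [leqRHS](bigD1 u) //= -addSn.
  apply: leq_add; first by have := a'E u; rewrite -v_last eqxx eq_sym (negPf v'u); lia.
  apply: leq_sum => x x'u; have := a'E x; rewrite -v_last (negPf x'u).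
  by case: (x =P v) vq => [->|_]; lia.
(* Otherwise no positive entry leaves K, so the row sums over K add up to the
   weight inside K, which is at most the sum of q over K; but each of them is at
   least q, and the one at u is larger. *)
have: (\sum_(x in K) \sum_(y in K) a x y = \sum_(x in K) \sum_y a x y)%N.
  apply: eq_bigr => x Kx; rewrite [RHS](bigID (mem K)) /= [X in (_ + X)%N]big1 ?addn0 //.
  move=> y; rewrite inE; apply: contraNeq; rewrite -lt0n => axy.
  by move: Kx; rewrite inE => Kx; apply: connect_trans Kx (connect1 axy).
have := q_ge K; rewrite (sum_splits (mem K) aw) leq_mul2l /= => + E; rewrite {}E leqNgt.
case/negP; rewrite (bigD1 u Ku) [ltnRHS](bigD1 u Ku) /= -addSn leq_add //.
apply: leq_sum => x /andP[Kx _]; move: (K_ge x); rewrite [x \in K]Kx /=; lia.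
Qed.

(** A and K have equally many elements outside their intersection, and the
    threshold c separates the values of f at those two groups. *)
Lemma leq_sum_exchange (V : finType) (f : V -> nat) (c : nat) (A K : {set V}) :
    #|A| = #|K| -> {in A :\: K, forall x, (f x <= c)%N} ->
    {in K :\: A, forall x, (c <= f x)%N} ->
  (\sum_(x in A) f x <= \sum_(x in K) f x)%N.
Proof.
move=> cardAK A_le K_ge; rewrite (big_setID K) [leqRHS](big_setID A) /= setIC leq_add2l.
apply: (@leq_trans (\sum_(x in A :\: K) c)%N); first exact: leq_sum.
apply: (@leq_trans (\sum_(x in K :\: A) c)%N); last exact: leq_sum.
rewrite !sum_nat_const leq_mul2r; apply/orP; right.
by have := cardsID K A; have := cardsID A K; rewrite setIC; lia.
Qed.

(** * The folded score inequalities *)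

(** The index [ord_max] stands for the middle row, which is its own reversal:
    this is why its pairs have weight 1 instead of 2. *)
Definition folded_weight (m : nat) (x y : 'I_m.+1) : nat :=
  ((x != y) + [&& x != y, x != ord_max & y != ord_max])%N.

Definition unfold_ord (n : nat) (n_odd : odd n) : 'I_n./2.+1 -> 'I_n :=
  widen_ord (half_ltn_odd n_odd).

Definition folded_score (n : nat) (n_odd : odd n) (R : 'rV[nat]_n)
    (x : 'I_n./2.+1) : nat :=
  if x == ord_max then (R ord0 (mid n_odd))./2 else R ord0 (unfold_ord n_odd x).

Lemma sum_neq (V : finType) (A : {set V}) :
  (\sum_(x in A) \sum_(y in A) (x != y) = #|A| * #|A|.-1)%N.
Proof.
rewrite -sum_nat_const; apply: eq_bigr => x Ax.
rewrite (bigD1 x Ax) /= eqxx add0n (cardsD1 x A) Ax /= -sum1_card.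
apply: eq_big => [y|y /andP[_ y'x]]; first by rewrite !inE andbC.
by rewrite eq_sym y'x.
Qed.

(** The two summands of the weight each count ordered pairs of distinct
    elements, of K and of K without the middle row. *)
Lemma sum_folded_weight (m : nat) (K : {set 'I_m.+1}) :
  (\sum_(x in K) \sum_(y in K) folded_weight x y =
   #|K| * #|K|.-1 + #|K :\ ord_max| * #|K :\ ord_max|.-1)%N.
Proof.
rewrite -!sum_neq; under eq_bigr do rewrite big_split.
rewrite big_split; congr (_ + _)%N; rewrite /= [LHS]big_mkcond [RHS]big_mkcond.
apply: eq_bigr => x _; rewrite !inE.
case: (x \in K); rewrite ?andbT ?andbF //; case: (altP (x =P _)) => /= [->|x'm].
  by rewrite big1 // => y _; rewrite andbF.
rewrite [LHS]big_mkcond [RHS]big_mkcond; apply: eq_bigr => y _; rewrite !inE.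
by case: (y == ord_max); rewrite ?andbF ?andbT //; case: (y \in K).
Qed.

Lemma setD1_notin (V : finType) (A : {set V}) (x : V) : x \notin A -> A :\ x = A.
Proof. by move=> A'x; apply/setDidPl; rewrite disjoint_sym disjoints1. Qed.

Lemma card_ord_lt (m k : nat) : (k <= m)%N -> #|[set x : 'I_m | x < k]%N| = k.
Proof.
move=> k_le; rewrite -sum1_card; under eq_bigl do rewrite inE.
by rewrite (big_ord_narrow k_le) sum1_card card_ord.
Qed.

Lemma card_notin_max (m : nat) (K : {set 'I_m.+1}) :
  ord_max \notin K -> (#|K| <= m)%N.
Proof.
by move=> K'm; have := max_card (ord_max |: K); rewrite cardsU1 K'm card_ord.
Qed.

Lemma prefix_sum_folded (n : nat) (n_odd : odd n) (R : 'rV[nat]_n) (k : nat) :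
  (k <= n./2)%N ->
  prefix_sum R k = (\sum_(x in [set x : 'I_n./2.+1 | x < k]) folded_score n_odd R x)%N.
Proof.
move=> k_le; under [RHS]eq_bigl do rewrite inE.
transitivity (\sum_(i < n | (i < k) && (i < n./2.+1)) R ord0 i)%N.
  by apply: eq_bigl => i; lia.
rewrite (big_ord_narrow_cond (half_ltn_odd n_odd)); apply: eq_bigr => x /= x_lt.
by rewrite /folded_score -val_eqE /= ltn_eqF // (leq_trans x_lt).
Qed.

(** The first rows have the smallest scores, so among the sets of a given size
    that avoid the middle row, the initial segment is extremal. *)
Lemma prefix_sum_min (n : nat) (n_odd : odd n) (R : 'rV[nat]_n)
    (K : {set 'I_n./2.+1}) :
  first_half_nondecreasing R -> ord_max \notin K ->
  (prefix_sum R #|K| <= \sum_(x in K) folded_score n_odd R x)%N.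
Proof.
move=> R_mono K'm; set k := #|K|.
have lt_half (x : 'I_n./2.+1) : x != ord_max -> (x < n./2)%N.
  by rewrite -val_eqE /=; have := ltn_ord x; lia.
have scoreE (x : 'I_n./2.+1) : (x < n./2)%N ->
    folded_score n_odd R x = R ord0 (unfold_ord n_odd x).
  by rewrite /folded_score -val_eqE /= => /ltn_eqF->.
have k_le : (k <= n./2)%N := card_notin_max K'm.
rewrite prefix_sum_folded //; case: (posnP k) => [k0|k_gt0].
  by rewrite big1 // => x; rewrite inE k0.
(* The score of the last row of the initial segment serves as threshold. *)
apply: (@leq_sum_exchange _ _ (folded_score n_odd R (inord k.-1))).
- by rewrite card_ord_lt // ltnW.
- move=> x; rewrite !inE => /andP[_ x_lt]; rewrite !scoreE ?inordK //; try lia.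
  by apply: R_mono; rewrite /= ?inordK //; lia.
move=> x; rewrite !inE => /andP[x_ge Kx].
have x_lt : (x < n./2)%N by apply: lt_half; apply: contraNneq K'm => <-.
rewrite !scoreE ?inordK //; try lia.
by apply: R_mono; rewrite /= ?inordK //; lia.
Qed.

(** Truncated subtraction on [nat] is the positive part. *)
Lemma score_bound_double (h k : nat) :
  score_bound h.*2 k = (k * k.-1 + (k - h))%:R.
Proof.
rewrite /score_bound /pos_part natrD -mul2n natrM mulrAC divff // mul1r.
congr (_ + _).
  by case: k => [|k]; rewrite ?mul0r //= natrM -natr1 addrK.
case: (leqP h k) => h_k.
  by rewrite natrB // max_r // subr_ge0 ler_nat.
by rewrite (eqP (ltnW h_k : (k - h == 0)%N)) max_l // subr_le0 ler_nat ltnW.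
Qed.

(** With the middle entry r at most 2m, the equality for k = m reads
    2 (r_1 + ... + r_m) + r = 2 m^2. *)
Lemma score_inequalities_even (n : nat) (n_odd : odd n) (R : 'rV[nat]_n) :
  (R ord0 (mid n_odd) <= n - 1)%N -> score_inequalities n_odd R ->
  ~~ odd (R ord0 (mid n_odd)).
Proof.
set r := R _ _ => r_le R_ineq; case: (posnP n./2) => [n0|n_gt0].
  have -> : r = 0%N by lia.
  by [].
(* As r <= 2m, the positive part is m - r / 2 itself. *)
have [_ /(_ erefl)] := R_ineq n./2 ltac:(lia).
rewrite /score_bound /pos_part -/r max_r; last first.
  by rewrite subr_ge0 ler_pdivrMr // -natrM ler_nat; lia.
move=> eq_half; have : (2 * prefix_sum R n./2 + r = 2 * (n./2 * n./2))%N.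
  by apply/eqP; rewrite -(eqr_nat rat) natrD !natrM eq_half; apply/eqP; field.
lia.
Qed.

(** The sets to test are the initial segments, with and without the middle
    row: they give the two inequalities that the positive part combines. *)
Lemma folded_inequalities (n : nat) (n_odd : odd n) (R : 'rV[nat]_n) :
    first_half_nondecreasing R -> ~~ odd (R ord0 (mid n_odd)) ->
  ((forall K : {set 'I_n./2.+1},
     (\sum_(x in K) \sum_(y in K) folded_weight x y <=
      2 * \sum_(x in K) folded_score n_odd R x)%N) /\
  (\sum_(x < n./2.+1) \sum_(y < n./2.+1) folded_weight x y =
   2 * \sum_(x < n./2.+1) folded_score n_odd R x)%N) <->
  ((R ord0 (mid n_odd) <= n - 1)%N /\ score_inequalities n_odd R).
Proof.
move=> R_mono R_even; set r := R _ _; set h := r./2.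
have rE : r = h.*2 by rewrite /h; lia.
pose f := folded_score n_odd R.
have f_max : f ord_max = h by rewrite /f /folded_score eqxx.
pose A k := [set x : 'I_n./2.+1 | x < k]%N.
have AE k : (k <= n./2)%N -> (ord_max \notin A k) * (#|A k| = k).
  by move=> k_le; rewrite inE -leqNgt card_ord_lt // ltnW.
have totalE : (\sum_(x < n./2.+1) f x = prefix_sum R n./2 + h)%N.
  rewrite (bigD1 ord_max) //= f_max addnC prefix_sum_folded //; congr (_ + _)%N.
  by apply: eq_bigl => x; rewrite inE -val_eqE /=; have := ltn_ord x; lia.
have weightE : (\sum_(x < n./2.+1) \sum_(y < n./2.+1) folded_weight x y =
    2 * (n./2 * n./2))%N.
  have := sum_folded_weight [set: 'I_n./2.+1].
  have := cardsD1 ord_max [set: 'I_n./2.+1]; rewrite inE cardsT card_ord add1n => -[<-].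
  under eq_bigl do rewrite inE; under eq_bigr do under eq_bigl do rewrite inE.
  by move=> ->; case: (n./2) => //= m; lia.
rewrite weightE totalE; split=> [[f_ge f_tot]|[r_le R_ineq]].
  have prefix_ge k : (k <= n./2)%N ->
      (k * k.-1 <= prefix_sum R k)%N /\ (k * k <= prefix_sum R k + h)%N.
    move=> k_le; split.
      have := f_ge (A k); rewrite sum_folded_weight -prefix_sum_folded //.
      by rewrite setD1_notin AE //; lia.
    have := f_ge (ord_max |: A k); rewrite sum_folded_weight big_setU1 ?AE //= -/f.
    rewrite -prefix_sum_folded // f_max setU1K ?AE // cardsU1 !AE //=.
    by case: k k_le => [|k] _ /=; lia.
  (* The total weight is 2 m^2, so the first m rows have sum m^2 - h; it is at
     least m (m - 1). *)
  have h_le : (h <= n./2)%N.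
    have [+ _] := prefix_ge _ (leqnn _); move: f_tot; case: (n./2) => [|m] /=; lia.
  split=> [|k /andP[k_gt0 k_le]]; first by rewrite rE; lia.
  rewrite -/r rE score_bound_double; have [ge1 ge2] := prefix_ge k k_le.
  split; first by rewrite ler_nat; case: k k_gt0 k_le ge1 ge2 => //= k; lia.
  move=> kE; congr _%:R; move: f_tot; rewrite -kE.
  by case: k k_gt0 k_le ge1 ge2 kE => //= k; lia.
have R_nat k : (k <= n./2)%N -> (k * k.-1 + (k - h) <= prefix_sum R k)%N /\
    (k = n./2 -> prefix_sum R k = k * k.-1 + (k - h))%N.
  case: (posnP k) => [->|k_gt0] k_le.
    by split=> // _; rewrite /prefix_sum big_pred0.
  have := R_ineq k; rewrite -/r rE score_bound_double k_gt0 k_le ler_nat.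
  case=> // ge0 eq0; split=> // /eq0 /eqP; rewrite eqr_nat => /eqP //.
split=> [K|]; last first.
  have [_ /(_ erefl)->] := R_nat _ (leqnn _).
  have : (h <= n./2)%N by rewrite -/r rE in r_le; lia.
  by case: (n./2) => [|m] //=; lia.
pose K' := K :\ ord_max.
have K'm : ord_max \notin K' by rewrite !inE eqxx.
have K'_ge := prefix_sum_min n_odd R_mono K'm.
have [K'_bound _] := R_nat _ (card_notin_max K'm).
rewrite sum_folded_weight -/K'; have := cardsD1 ord_max K.
rewrite -/K'; have [Km|K'm'] := boolP (ord_max \in K).
  rewrite add1n => ->; rewrite (big_setD1 _ Km) /= -/f f_max -/K'.
  apply: leq_trans (leq_mul (leqnn 2) (leq_add (leqnn h) K'_ge)).
  by case: #|K'| K'_bound => [|k] /=; lia.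
move=> _; rewrite (setD1_notin K'm' : K' = K) in K'_bound K'_ge *.
by case: #|K| K'_bound K'_ge => [|k] /=; lia.
Qed.

(** * Folding a skew-Hankel tournament *)

Definition fold_ord (n : nat) (i : 'I_n) : 'I_n./2.+1 := inord (minn i (rev_ord i)).

Lemma val_fold_ord (n : nat) (i : 'I_n) : fold_ord i = minn i (n - i.+1) :> nat.
Proof. by rewrite /fold_ord inordK //=; have := ltn_ord i; lia. Qed.

Lemma fold_rev_ord (n : nat) (i : 'I_n) : fold_ord (rev_ord i) = fold_ord i.
Proof. by rewrite /fold_ord rev_ordK minnC. Qed.

Lemma unfold_ordK (n : nat) (n_odd : odd n) :
  cancel (unfold_ord n_odd) (@fold_ord n).
Proof.
by move=> x; apply: val_inj; rewrite /= val_fold_ord /=; have := ltn_ord x; lia.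
Qed.

Lemma fold_ord_eq (n : nat) (i j : 'I_n) :
  (fold_ord i == fold_ord j) = (j == i) || (j == rev_ord i).
Proof.
rewrite -!val_eqE /= !val_fold_ord; have := ltn_ord i; have := ltn_ord j; lia.
Qed.

Lemma rev_unfold_max (n : nat) (n_odd : odd n) (x : 'I_n./2.+1) :
  (rev_ord (unfold_ord n_odd x) == unfold_ord n_odd x) = (x == ord_max).
Proof. by rewrite -!val_eqE /=; have := ltn_ord x; lia. Qed.

Lemma unfold_max (n : nat) (n_odd : odd n) : unfold_ord n_odd ord_max = mid n_odd.
Proof. exact: val_inj. Qed.

Lemma sum_unfold (n : nat) (n_odd : odd n) (F : 'I_n -> nat) :
  (\sum_j F j = \sum_(y < n./2.+1)
     (F (unfold_ord n_odd y) + (y != ord_max) * F (rev_ord (unfold_ord n_odd y))))%N.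
Proof.
rewrite (partition_big (@fold_ord n) xpredT) //=; apply: eq_bigr => y _.
rewrite -{1}(unfold_ordK n_odd y); set u := unfold_ord n_odd y.
rewrite (bigD1 u) //=; congr (_ + _)%N; rewrite -(rev_unfold_max n_odd) -/u.
under eq_bigl do rewrite eq_sym fold_ord_eq andb_orl andbN orFb.
have [rev_u|rev'u] := eqVneq (rev_ord u) u.
  by rewrite big_pred0 // => j; rewrite rev_u andbN.
rewrite mul1n (big_pred1 (rev_ord u)) // => j /=.
by case: (j =P rev_ord u) => //= ->.
Qed.

(** This form of the definition refers to the folded indices only through
    equality; the half-turn symmetry is obtained by complementing twice. *)
Lemma comb_skew_HankelP (n : nat) (T : 'M[nat]_n) :
  comb_skew_Hankel_tournament T <->
  [/\ forall i j, fold_ord i = fold_ord j -> T i j = 0%N,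
      forall i j, fold_ord i != fold_ord j -> (T i j + T j i = 1)%N
    & forall i j, T (rev_ord i) (rev_ord j) = T i j].
Proof.
split=> [[T01 T0 TC]|[T0 TC Trev]]; last first.
  split=> [i j|i|i j j'i j'rev].
  - have [/T0->|/TC] := eqVneq (fold_ord i) (fold_ord j); first by left.
    by case: (T i j) => [|[|?]]; auto.
  - by rewrite !T0 ?fold_rev_ord.
  - rewrite Trev; have := TC i j; rewrite fold_ord_eq (negPf j'i) (negPf j'rev).
    by move=> /(_ isT) <-; rewrite addKn.
have T0' i j : fold_ord i = fold_ord j -> T i j = 0%N.
  by move/eqP; rewrite fold_ord_eq => /pred2P[]->; case: (T0 i).
have TC' i j : fold_ord i != fold_ord j ->
    (T i j + T j i = 1)%N /\ (T (rev_ord i) (rev_ord j) = T i j)%N.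
  rewrite fold_ord_eq negb_or => /andP[j'i j'rev].
  have i'j : i != j by rewrite eq_sym.
  have i'rev : i != rev_ord j by apply: contraNneq j'rev => ->; rewrite rev_ordK.
  have [Tji _] := TC _ _ j'i j'rev; have [Tij ->] := TC _ _ i'j i'rev.
  by rewrite -Tij Tji; split=> //; case: (T01 i j) => ->.
split=> // i j; first by case/TC'.
have [ij|/TC'[]//] := eqVneq (fold_ord i) (fold_ord j).
by rewrite !T0' ?fold_rev_ord.
Qed.

(** The middle column has a single entry.  In the middle row the entries at y
    and y' coincide, and counting just one of them is what gives the pairs of
    the middle row weight 1. *)
Definition folded (n : nat) (n_odd : odd n) (T : 'M[nat]_n) (x y : 'I_n./2.+1) : nat :=
  (T (unfold_ord n_odd x) (unfold_ord n_odd y) +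
   [&& x != ord_max & y != ord_max] *
     T (unfold_ord n_odd x) (rev_ord (unfold_ord n_odd y)))%N.

Lemma folded_splits (n : nat) (n_odd : odd n) (T : 'M[nat]_n) :
  comb_skew_Hankel_tournament T -> splits (@folded_weight n./2) (folded n_odd T).
Proof.
case/comb_skew_HankelP=> T0 TC Trev x y; rewrite /folded /folded_weight.
set u := unfold_ord n_odd x; set v := unfold_ord n_odd y.
have fold_uv : (fold_ord u == fold_ord v) = (x == y) by rewrite !unfold_ordK.
rewrite [(y != _) && _]andbC; have [xy|x'y] := eqVneq x y; move: fold_uv.
  by rewrite xy eqxx => /eqP uv; rewrite !T0 ?fold_rev_ord // !muln0.
rewrite (negPf x'y) => /negbT uv; rewrite -[T v (rev_ord u)]Trev rev_ordK /=.
have := TC _ _ uv; have := TC u (rev_ord v); rewrite fold_rev_ord => /(_ uv).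
by case: (_ && _) => /=; lia.
Qed.

(** The factor 2 in the middle row makes up for the entries at y' that its
    folding leaves out. *)
Lemma row_sum_unfold (n : nat) (n_odd : odd n) (T : 'M[nat]_n) (x : 'I_n./2.+1) :
  comb_skew_Hankel_tournament T ->
  (\sum_j T (unfold_ord n_odd x) j = (x == ord_max).+1 * \sum_y folded n_odd T x y)%N.
Proof.
case/comb_skew_HankelP=> T0 _ Trev; rewrite (sum_unfold n_odd) big_distrr /=.
apply: eq_bigr => y _; rewrite /folded; have [x_max|_] := eqVneq x ord_max.
  rewrite addn0 -[T _ (rev_ord _)]Trev rev_ordK.
  have /eqP-> : rev_ord (unfold_ord n_odd x) == unfold_ord n_odd x.
    by rewrite rev_unfold_max x_max.
  have [->|_] := eqVneq y ord_max; last by rewrite mul1n mul2n addnn.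
  by rewrite x_max T0.
by rewrite mul1n.
Qed.

Lemma score_vector_folded (n : nat) (n_odd : odd n) (T : 'M[nat]_n) (R : 'rV[nat]_n) :
    palindromic R -> comb_skew_Hankel_tournament T ->
  score_vector T = R <->
  ~~ odd (R ord0 (mid n_odd)) /\
  forall x, (\sum_y folded n_odd T x y)%N = folded_score n_odd R x.
Proof.
move=> R_pal TH; have row_sum x := row_sum_unfold n_odd x TH.
split=> [TR|[R_even TR]].
  have RE x : R ord0 (unfold_ord n_odd x) =
      ((x == ord_max).+1 * \sum_y folded n_odd T x y)%N by rewrite -TR mxE.
  have := RE ord_max; rewrite unfold_max eqxx mul2n => R_mid.
  split=> [|x]; first by rewrite R_mid odd_double.
  rewrite /folded_score R_mid doubleK; case: eqVneq => [->//|x'm].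
  by rewrite RE (negPf x'm) mul1n.
have TR' x : (\sum_j T (unfold_ord n_odd x) j)%N = R ord0 (unfold_ord n_odd x).
  rewrite row_sum TR /folded_score; case: eqVneq => [->|_]; last by rewrite mul1n.
  by rewrite unfold_max mul2n even_halfK.
case/comb_skew_HankelP: TH => _ _ Trev; apply/rowP=> i; rewrite mxE.
have /eqP := unfold_ordK n_odd (fold_ord i); rewrite fold_ord_eq => /pred2P[]->.
  exact: TR'.
rewrite R_pal -TR' (reindex_inj rev_ord_inj) /=; apply: eq_bigr => j _.
exact: Trev.
Qed.

(** Of the two entries of row i in the columns j and j', one takes the first
    point of a x y and the other the second.  Complementation exchanges the
    roles: if a x y = a y x = 1, an entry that takes the first point must have
    a transposed entry that asks for the second. *)
Lemma unfold_splits (n : nat) (n_odd : odd n) (a : 'I_n./2.+1 -> 'I_n./2.+1 -> nat) :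
    splits (@folded_weight n./2) a ->
  exists2 T : 'M[nat]_n, comb_skew_Hankel_tournament T & folded n_odd T =2 a.
Proof.
move=> aw.
(* Reversing i or j alone changes the first part of the exclusive or, exchanging
   i and j changes only the last one.  Pairs with the middle row have only one
   point to give. *)
pose second (i j : 'I_n) := [&& fold_ord i != ord_max, fold_ord j != ord_max &
  (i < n./2)%N (+) (j < n./2)%N (+) (fold_ord j < fold_ord i)%N] : bool.
pose T : 'M[nat]_n := \matrix_(i, j) ((fold_ord i != fold_ord j) &&
  (second i j < a (fold_ord i) (fold_ord j))%N : nat).
have TH : comb_skew_Hankel_tournament T.
  apply/comb_skew_HankelP; split=> [i j ij|i j i'j|i j]; rewrite !mxE.
  - by rewrite ij eqxx.
  - rewrite [fold_ord j == _]eq_sym i'j /second.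
    have := aw (fold_ord i) (fold_ord j); rewrite /folded_weight i'j /=.
    have : (fold_ord j < fold_ord i)%N = ~~ (fold_ord i < fold_ord j)%N.
      by move: i'j; rewrite -val_eqE /=; lia.
    move=> ->.
    by case: (fold_ord i != ord_max); case: (fold_ord j != ord_max) => /=; lia.
  - rewrite !fold_rev_ord /second !fold_rev_ord.
    have rev_lt (k : 'I_n) : fold_ord k != ord_max ->
        (rev_ord k < n./2)%N = ~~ (k < n./2)%N.
      by rewrite -val_eqE /= val_fold_ord; have := ltn_ord k; lia.
    case: eqVneq => //= _; have [_|i_m] := eqVneq (fold_ord i); first by [].
    have [_|j_m] := eqVneq (fold_ord j); first by [].
    by rewrite !rev_lt // addbN !addNb negbK.
exists T => // x y; rewrite /folded !mxE fold_rev_ord !unfold_ordK.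
have [<-|x'y] := eqVneq x y.
  by have := aw x x; rewrite /folded_weight eqxx /=; lia.
rewrite /second fold_rev_ord !unfold_ordK.
have := aw x y; rewrite /folded_weight x'y /=.
have lt_half (z : 'I_n./2.+1) : z != ord_max -> (z < n./2)%N.
  by rewrite -val_eqE /=; have := ltn_ord z; lia.
have [x_max|x'm] := eqVneq x ord_max; first by rewrite /=; lia.
have [y_max|y'm] := eqVneq y ord_max; first by rewrite /=; lia.
have -> : (n - y.+1 < n./2)%N = false by have := lt_half y y'm; lia.
by rewrite /= !lt_half //=; case: (y < x)%N => /=; lia.
Qed.

(* The bound R ord0 (mid n_odd) <= n - 1 cannot be dropped: every row sum is at
   most n - 1, but the positive part makes the inequalities insensitive to a
   larger middle entry; R = (0, 3, 0) satisfies them and is not a score vector. *)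
Theorem theorem24 (n : nat) (n_odd : odd n) (R : 'rV[nat]_n)
    (R_pal : palindromic R) (R_mono : first_half_nondecreasing R) :
  (exists T : 'M[nat]_n,
     comb_skew_Hankel_tournament T /\ score_vector T = R) <->
  ((R ord0 (mid n_odd) <= n - 1)%N /\ score_inequalities n_odd R).
Proof.
have wC (x y : 'I_n./2.+1) : folded_weight x y = folded_weight y x.
  by rewrite /folded_weight eq_sym [(x != _) && _]andbC.
have w0 (x : 'I_n./2.+1) : folded_weight x x = 0%N by rewrite /folded_weight eqxx.
have realizable := splits_with_sums (folded_score n_odd R) wC w0.
split=> [[T [TH /(score_vector_folded n_odd R_pal TH)[R_even TR]]]|R_ineq].
  apply/(folded_inequalities R_mono R_even)/realizable.
  by exists (folded n_odd T) => //; apply: folded_splits.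
have R_even := score_inequalities_even R_ineq.1 R_ineq.2.
have [a aw aR] := realizable.2 ((folded_inequalities R_mono R_even).2 R_ineq).
have [T TH Ta] := unfold_splits n_odd aw.
exists T; split=> //; apply/(score_vector_folded n_odd R_pal TH); split=> // x.
by rewrite -aR; apply: eq_bigr => y _; apply: Ta.
Qed.
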